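(* Suppose the programming language is computably empty-frequent, and consider variant E of the halting problem. Then $$\forall T \in \textnormal{three-way(E)}: \exists c_T > 0: \exists n_T \in \mathbb{N}: \forall n \geq n_T: \frac{\overline d_T(n)}{p(n)} \geq c_T .$$ The same statement holds with generic(E) in place of three-way(E), but the analogous statement with approx(E) in place of three-way(E) is false.
   Context: Programs are strings over a finite alphabet $\Sigma$ ($|\Sigma|\ge2$) in a Turing-complete programming language in which programs can be effectively constructed, can refer to their own code, and can run other programs as subroutines or in parallel; each program on each input halts or runs forever; $p(n)$ is the number of programs of size (length) $n$. The language is computably empty-frequent if there is a decidable equivalence relation $\approx$ on programs such that (i) for each program $\pi$ there are $c_\pi>0$ and $n_\pi\in\mathbb{N}$ such that for every $n\ge n_\pi$ at least $c_\pi p(n)$ programs of size $n$ are equivalent to $\pi$, and (ii) if $\pi\approx\pi'$ then either both or neither of $\pi,\pi'$ halt on the empty input. Variant E: instances are programs; the question is whether the program halts on the empty input. A three-way tester always halts answering ``yes'', ``no'' or ``I don't know'', where ``yes''/``no'' must be correct; a generic-case tester on each instance either halts with a correct ``yes''/``no'' or fails to halt; an approximating tester always halts answering ``yes'' or ``no'', possibly incorrectly. three-way(E), generic(E), approx(E) denote the sets of such testers. An instance is hard for $T$ unless $T$ answers it correctly with ``yes'' or ``no''. $\overline d_T(n)$ is the number of hard non-halting instances of size $n$. *)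

(* Defs.v *)
From HB Require Import structures.
From mathcomp Require Import all_boot all_order all_algebra.
From mathcomp Require Import reals.

Set Implicit Arguments.
Unset Strict Implicit.
Unset Printing Implicit Defensive.

Import Order.TTheory GRing.Theory Num.Theory.

(** ** Partial recursive functions

  Arities are not tracked: a term is applied to a list of arguments, missing
  arguments read as 0 and extra ones are ignored.  Restricted to lists of
  length k, the terms define exactly the partial recursive functions of k
  variables. *)

Inductive recf : Type :=
| Zero
| Succ
| Proj of nat
| Comp of recf & seq recf
| Prec of recf & recf
| Mu of recf.

Fixpoint prec_graph (base : nat -> Prop) (step : nat -> nat -> nat -> Prop)
    (n y : nat) : Prop :=
  if n is m.+1 then exists2 z, prec_graph base step m z & step m z y
  else base y.

(* [eval f v y] : on arguments [v], [f] is defined with value [y].  Composition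
   is strict; [Mu f] is the least [y] with [f (y :: v) = 0], all the smaller
   arguments giving defined nonzero values. *)
Fixpoint eval (f : recf) (v : seq nat) (y : nat) {struct f} : Prop :=
  match f with
  | Zero => y = 0
  | Succ => y = (head 0 v).+1
  | Proj i => y = nth 0 v i
  | Comp g hs =>
      exists2 w : seq nat,
        (fix evals (hs : seq recf) (w : seq nat) {struct hs} : Prop :=
           match hs, w with
           | [::], [::] => True
           | h :: hs', x :: w' => eval h v x /\ evals hs' w'
           | _, _ => False
           end) hs w
        & eval g w y
  | Prec g h =>
      prec_graph (eval g (behead v))
        (fun m z => eval h [:: m, z & behead v]) (head 0 v) y
  | Mu g =>
      eval g (y :: v) 0 /\
      forall i, i < y -> exists2 z, eval g (i :: v) z & 0 < z
  end.

(** ** Computability on strings *)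

(* Bijective base-|Sigma| numeration, a bijection between strings and natural
   numbers as soon as Sigma is nonempty; the head of the list is the least
   significant digit. *)
Definition code (Sigma : finType) (w : seq Sigma) : nat :=
  foldr (fun a m => (m * #|Sigma| + enum_rank a).+1) 0 w.

(* [None] is the undefined value; nothing is required outside the domains. *)
Definition computable1 (Sigma : finType) (D : pred (seq Sigma))
    (F : seq Sigma -> option nat) : Prop :=
  exists f : recf, forall x, D x ->
    forall r, eval f [:: code x] r <-> F x = Some r.

Definition computable2 (Sigma : finType) (D E : pred (seq Sigma))
    (F : seq Sigma -> seq Sigma -> option nat) : Prop :=
  exists f : recf, forall x y, D x -> E y ->
    forall r, eval f [:: code x; code y] r <-> F x y = Some r.

(** ** Programming languages *)

(* [run pi x = None] means that [pi] runs forever on input [x];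
   [run pi x = Some y] that it halts with output [y].  The value of [run] on
   strings that are not programs is irrelevant. *)
Record language (Sigma : finType) := Language {
  prog : pred (seq Sigma);
  run : seq Sigma -> seq Sigma -> option (seq Sigma)
}.

(* The usual notion of an acceptable programming system: syntax is decidable,
   the language has a computable interpreter, and every computable family of
   partial computable functions is implemented by an effectively constructed
   family of programs.  Self-reference (Kleene's recursion theorem) and the
   ability to run programs as subroutines or in parallel follow from these. *)
Record turing_complete (Sigma : finType) (L : language Sigma) : Prop := {
  prog_decidable : computable1 predT (fun w => Some (nat_of_bool (prog L w)));
  run_computable :
    computable2 (prog L) predT (fun pi x => omap (@code Sigma) (run L pi x));
  run_complete : forall F : seq Sigma -> seq Sigma -> option (seq Sigma),
    computable2 predT predT (fun z x => omap (@code Sigma) (F z x)) ->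
    exists s : seq Sigma -> seq Sigma,
      computable1 predT (fun z => Some (code (s z))) /\
      forall z, prog L (s z) /\ forall x, run L (s z) x = F z x
}.

Definition halts (Sigma : finType) (L : language Sigma) (pi x : seq Sigma) :
  bool := isSome (run L pi x).

Definition halts_empty (Sigma : finType) (L : language Sigma)
  (pi : seq Sigma) : bool := halts L pi [::].

(* The number of programs of size n. *)
Definition nprog (Sigma : finType) (L : language Sigma) (n : nat) : nat :=
  #|[set w : n.-tuple Sigma | prog L w]|.

Definition computably_empty_frequent (R : realType) (Sigma : finType)
    (L : language Sigma) : Prop :=
  exists eqv : rel (seq Sigma),
    [/\ {in prog L & &, equivalence_rel eqv},
        computable2 (prog L) (prog L)
          (fun pi pi' => Some (nat_of_bool (eqv pi pi'))),
        forall pi, prog L pi ->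
          exists2 c : R, (0 < c)%R & exists n0 : nat, forall n, n0 <= n ->
            (c * (nprog L n)%:R
              <= #|[set w : n.-tuple Sigma | prog L w && eqv w pi]|%:R)%R
      & forall pi pi', prog L pi -> prog L pi' -> eqv pi pi' ->
          halts_empty L pi = halts_empty L pi'].

(** ** Testers for halting on the empty input *)

Inductive answer := Yes | No | DontKnow.

Definition answer_code (a : answer) : nat :=
  match a with No => 0 | Yes => 1 | DontKnow => 2 end.

(* A tester is represented by the partial function it computes; [None] means
   that it does not halt. *)
Definition tester (Sigma : finType) := seq Sigma -> option answer.

Definition tester_computable (Sigma : finType) (L : language Sigma)
    (T : tester Sigma) : Prop :=
  computable1 (prog L) (fun pi => omap answer_code (T pi)).

Definition sound (Sigma : finType) (L : language Sigma) (T : tester Sigma) :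
    Prop :=
  forall pi, prog L pi ->
    (T pi = Some Yes -> halts_empty L pi) /\
    (T pi = Some No -> ~~ halts_empty L pi).

Definition three_way (Sigma : finType) (L : language Sigma)
    (T : tester Sigma) : Prop :=
  [/\ tester_computable L T,
      forall pi, prog L pi -> T pi <> None
    & sound L T].

Definition generic (Sigma : finType) (L : language Sigma)
    (T : tester Sigma) : Prop :=
  [/\ tester_computable L T,
      forall pi, prog L pi -> T pi <> Some DontKnow
    & sound L T].

Definition approx (Sigma : finType) (L : language Sigma)
    (T : tester Sigma) : Prop :=
  tester_computable L T /\
  forall pi, prog L pi -> T pi = Some Yes \/ T pi = Some No.

Definition answers_correctly (Sigma : finType) (L : language Sigma)
    (T : tester Sigma) (pi : seq Sigma) : bool :=
  match T pi with
  | Some Yes => halts_empty L pi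
  | Some No => ~~ halts_empty L pi
  | _ => false
  end.

Definition hard (Sigma : finType) (L : language Sigma) (T : tester Sigma)
  (pi : seq Sigma) : bool := ~~ answers_correctly L T pi.

(* The number of hard non-halting instances of size n. *)
Definition dbar (Sigma : finType) (L : language Sigma) (T : tester Sigma)
    (n : nat) : nat :=
  #|[set w : n.-tuple Sigma |
      [&& prog L w, hard L T w & ~~ halts_empty L w]]|.

(* The ratio is meaningless at the sizes n for which there is no program, and
   nothing is claimed there; [turing_complete] makes the remaining sizes
   unbounded. *)
Definition hard_nonhalting_frequent (R : realType) (Sigma : finType)
    (L : language Sigma) (T : tester Sigma) : Prop :=
  exists2 c : R, (0 < c)%R & exists n0 : nat, forall n, n0 <= n ->
    0 < nprog L n -> (c <= (dbar L T n)%:R / (nprog L n)%:R)%R.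

(* Main.v *)
(** Given a tester T whose definite answers are correct, let P be a program that
  searches in parallel for a program w equivalent to P with T w = No, and halts
  if it finds one.  If P halted, then so would w, against the answer of T.
  Hence P runs forever and T answers No on no program equivalent to P: the whole
  class of P, which has positive frequency, consists of hard non-halting
  instances.  Self-reference comes from Kleene's recursion theorem, and the
  parallel search from the fact that, for each fixed term, evaluation with
  bounded fuel is a total recursive function.

  An approximating tester that always answers No is right on all non-halting
  instances, so it has no hard ones. *)

Require Import Defs.
From mathcomp Require Import all_boot all_order all_algebra.
From mathcomp Require Import reals.
From Stdlib Require List.
From mathcomp Require Import boolp filter.

Set Implicit Arguments.
Unset Strict Implicit.
Unset Printing Implicit Defensive.

Import Order.TTheory GRing.Theory Num.Theory.
Local Open Scope classical_set_scope.

Local Notation Forall := List.Forall.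

Lemma recf_nested_ind (P : recf -> Prop) :
  P Zero -> P Succ -> (forall i, P (Proj i)) ->
  (forall g hs, P g -> Forall P hs -> P (Comp g hs)) ->
  (forall g h, P g -> P h -> P (Prec g h)) ->
  (forall g, P g -> P (Mu g)) -> forall f, P f.
Proof.
move=> PZero PSucc PProj PComp PPrec PMu; fix IH 1; case=> [||i|g hs|g h|g].
- exact: PZero.
- exact: PSucc.
- exact: PProj.
- apply: PComp; first exact: IH.
  by elim: hs => [|h hs IHhs]; constructor.
- by apply: PPrec; apply: IH.
- by apply: PMu; apply: IH.
Qed.

(* A name for the fixpoint local to [eval]. *)
Definition evals (v : seq nat) :=
  fix evals (hs : seq recf) (w : seq nat) {struct hs} : Prop :=
    match hs, w with
    | [::], [::] => True
    | h :: hs', x :: w' => eval h v x /\ evals hs' w'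
    | _, _ => False
    end.

Lemma eval_Comp g hs v y :
  eval (Comp g hs) v y = exists2 w, evals v hs w & eval g w y.
Proof. by []. Qed.

Lemma eval_Comp1 g h v y :
  eval (Comp g [:: h]) v y <-> exists2 x, eval h v x & eval g [:: x] y.
Proof.
rewrite eval_Comp; split; first by case=> -[|x [|? ?]] [] // hx _; exists x.
by case=> x hx gxy; exists [:: x].
Qed.

Lemma eval_Comp2 g h1 h2 v y :
  eval (Comp g [:: h1; h2]) v y <->
  exists x1 x2, [/\ eval h1 v x1, eval h2 v x2 & eval g [:: x1; x2] y].
Proof.
rewrite eval_Comp; split.
  by case=> -[|x1 [|x2 [|? ?]]] [] // hx1 [] // hx2 _; exists x1, x2.
by case=> x1 [x2 [hx1 hx2 gxy]]; exists [:: x1; x2].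
Qed.

(** * Total recursive functions *)

Definition recursive (a : nat) (F : seq nat -> nat) : Prop :=
  exists f : recf, forall v, size v = a -> forall y, eval f v y <-> y = F v.

Lemma eq_recursive a F G :
  (forall v, size v = a -> F v = G v) -> recursive a F -> recursive a G.
Proof. by move=> FG [f fF]; exists f => v sv y; rewrite -FG // fF. Qed.

Lemma recursive_nth a i : recursive a (fun v => nth 0 v i).
Proof. by exists (Proj i). Qed.

Lemma recursive_comp a (Hs : seq (seq nat -> nat)) G :
  recursive (size Hs) G -> Forall (recursive a) Hs ->
  recursive a (fun v => G [seq H v | H <- Hs]).
Proof.
case=> g gG recHs.
have [hs hsHs] : exists hs, forall v, size v = a ->
    forall w, evals v hs w <-> w = [seq H v | H <- Hs].
  elim: recHs {gG} => [|H Hs' [h hH] _ [hs hsHs']].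
    by exists [::] => v _ [|x w].
  exists (h :: hs) => v sv [|x w] //=; split.
    by case=> /(hH v sv)-> /(hsHs' v sv)->.
  by case=> /(hH v sv) ? /(hsHs' v sv).
exists (Comp g hs) => v sv y; rewrite eval_Comp; split.
  by case=> w /(hsHs v sv)->; rewrite gG // size_map.
move=> ->; exists [seq H v | H <- Hs]; first exact/hsHs.
by rewrite gG // size_map.
Qed.

Definition projections (m a : nat) : seq (seq nat -> nat) :=
  [seq (fun v => nth 0 v i) | i <- iota m a].

Lemma size_projections m a : size (projections m a) = a.
Proof. by rewrite size_map size_iota. Qed.

Lemma Forall_recursive_projections b m a :
  Forall (recursive b) (projections m a).
Proof.
rewrite /projections; elim: a m => [|a IH] m /=; constructor=> //.
exact: recursive_nth.
Qed.

Lemma map_projections m a v : size v = m + a ->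
  [seq H v | H <- projections m a] = drop m v.
Proof.
move=> sv; rewrite -map_comp (eq_map (g := nth 0 v)) //.
by rewrite map_nth_iota ?sv ?addKn // take_oversize // size_drop sv addKn.
Qed.

Lemma recursive_behead a F :
  recursive a F -> recursive a.+1 (fun v => F (behead v)).
Proof.
move=> recF; have := @recursive_comp a.+1 (projections 1 a) F.
rewrite size_projections => /(_ recF (Forall_recursive_projections _ _ _)).
by apply: eq_recursive => v sv; rewrite map_projections // drop1.
Qed.

Lemma Forall_recursive_behead a Hs : Forall (recursive a) Hs ->
  Forall (recursive a.+1) [seq (fun v => H (behead v)) | H <- Hs].
Proof.
move=> recHs; apply/List.Forall_map; apply: List.Forall_impl recHs => H.
exact: recursive_behead.
Qed.

Lemma recursive_iteri a N G H :
  recursive a N -> recursive a G -> recursive a.+2 H ->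
  recursive a (fun v => iteri (N v) (fun m z => H [:: m, z & v]) (G v)).
Proof.
move=> recN [g gG] [h hH].
pose rec v :=
  iteri (head 0 v) (fun m z => H [:: m, z & behead v]) (G (behead v)).
have rec_recursive : recursive a.+1 rec.
  exists (Prec g h) => -[|n v] //= [sv].
  elim: n => [|n IH] y /=; first exact: gG.
  split; first by case=> z /IH-> /hH-> //=; rewrite sv.
  by move=> ->; eexists; [apply/IH | apply/hH => //=; rewrite sv].
have := @recursive_comp a (N :: projections 0 a) rec.
rewrite /= size_projections => /(_ rec_recursive) comp_recursive.
apply: eq_recursive (comp_recursive _) => [v sv|].
  by rewrite map_projections // drop0.
by constructor=> //; apply: Forall_recursive_projections.
Qed.

Lemma recursive_succ a F : recursive a F -> recursive a (fun v => (F v).+1).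
Proof.
move=> recF; apply: (@recursive_comp a [:: F] (fun v => (head 0 v).+1)).
  by exists Succ.
by constructor.
Qed.

Lemma recursive_const a c : recursive a (fun=> c).
Proof. by elim: c => [|c]; [exists Zero | apply: recursive_succ]. Qed.

Lemma recursive_pred a F : recursive a F -> recursive a (fun v => (F v).-1).
Proof.
move=> recF; apply: eq_recursive
  (recursive_iteri recF (recursive_const a 0) (recursive_nth _ 0)).
by move=> v _; case: (F v).
Qed.

Lemma recursive_if a (C : seq nat -> bool) A B :
  recursive a (fun v => C v : nat) -> recursive a A -> recursive a B ->
  recursive a (fun v => if C v then A v else B v).
Proof.
move=> recC recA recB; apply: eq_recursive
  (recursive_iteri recC recB (recursive_behead (recursive_behead recA))).
by move=> v _; case: (C v).
Qed.

Lemma recursive_sub a F G :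
  recursive a F -> recursive a G -> recursive a (fun v => F v - G v).
Proof.
move=> recF recG; apply: eq_recursive
  (recursive_iteri recG recF (recursive_pred (recursive_nth _ 1))).
by move=> v _; elim: (G v) => [|n /= ->]; rewrite ?subn0 ?subnS.
Qed.

Lemma recursive_eq0 a F :
  recursive a F -> recursive a (fun v => F v == 0 : nat).
Proof.
move=> recF; apply: eq_recursive
  (recursive_iteri recF (recursive_const a 1) (recursive_const _ 0)).
by move=> v _; case: (F v).
Qed.

Lemma recursive_leq a F G : recursive a F -> recursive a G ->
  recursive a (fun v => F v <= G v : nat).
Proof. by move=> recF recG; apply/recursive_eq0/recursive_sub. Qed.

Lemma recursive_eq a F G : recursive a F -> recursive a G ->
  recursive a (fun v => F v == G v : nat).
Proof.
move=> recF recG; apply: eq_recursive (recursive_if (recursive_leq recF recG)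
  (recursive_leq recG recF) (recursive_const a 0)).
by move=> v _; rewrite eqn_leq; case: (_ <= _).
Qed.

Lemma recursive_negb a (P : seq nat -> bool) :
  recursive a (fun v => P v : nat) -> recursive a (fun v => ~~ P v : nat).
Proof.
by move/recursive_eq0; apply: eq_recursive => v _; case: (P v).
Qed.

Lemma recursive_mem0 a Hs : Forall (recursive a) Hs ->
  recursive a (fun v => 0 \in [seq H v | H <- Hs] : nat).
Proof.
elim=> [|H Hs' recH _ IH]; first exact: recursive_const.
apply: eq_recursive
  (recursive_if (recursive_eq0 recH) (recursive_const a 1) IH) => v _.
by rewrite /= in_cons eq_sym; case: eqP.
Qed.

Lemma find_iota_iteri (P : pred nat) n :
  find P (iota 0 n) = iteri n (fun _ j => if P j then j else j.+1) 0.
Proof.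
elim: n => [|n IH] //; rewrite iteriS -IH -addn1 iotaD find_cat size_iota /=.
case: findP => [_|i]; rewrite size_iota.
  by case: (P n); rewrite ?addn0 ?addn1.
by move=> lt_in /(_ 0); rewrite nth_iota // add0n => ->.
Qed.

Lemma recursive_find a N (P : seq nat -> bool) :
  recursive a N -> recursive a.+1 (fun v => P v : nat) ->
  recursive a (fun v => find (fun j => P (j :: v)) (iota 0 (N v))).
Proof.
move=> recN recP; have recz := recursive_nth a.+2 1.
have recstep : recursive a.+2
    (fun v => if P (behead v) then nth 0 v 1 else (nth 0 v 1).+1).
  exact: recursive_if (recursive_behead recP) recz (recursive_succ recz).
apply: eq_recursive (recursive_iteri recN (recursive_const a 0) recstep) => v _.
by rewrite find_iota_iteri.
Qed.

Lemma recursive_has a N (P : seq nat -> bool) :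
  recursive a N -> recursive a.+1 (fun v => P v : nat) ->
  recursive a (fun v => has (fun j => P (j :: v)) (iota 0 (N v)) : nat).
Proof.
move=> recN recP; apply: eq_recursive
  (recursive_leq (recursive_succ (recursive_find recN recP)) recN) => v _.
by rewrite has_find size_iota.
Qed.

Lemma before_find_iota (P : pred nat) n i : i < find P (iota 0 n) -> ~~ P i.
Proof.
move=> lt_i; have := before_find 0 lt_i.
have := find_size P (iota 0 n); rewrite size_iota => le_n.
by rewrite nth_iota ?(leq_trans lt_i) // => ->.
Qed.

(** * Evaluation with bounded fuel *)

(* The fuel [k] bounds every unbounded search.  The result is 0 if the fuel is
   insufficient, and [y.+1] if the value is [y]. *)
Fixpoint eval_fuel (k : nat) (f : recf) (v : seq nat) {struct f} : nat :=
  match f with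
  | Zero => 1
  | Succ => (head 0 v).+2
  | Proj i => (nth 0 v i).+1
  | Comp g hs =>
      let ws := [seq eval_fuel k h v | h <- hs] in
      if 0 \in ws then 0 else eval_fuel k g [seq w.-1 | w <- ws]
  | Prec g h =>
      iteri (head 0 v)
        (fun m z => if z == 0 then 0 else eval_fuel k h [:: m, z.-1 & behead v])
        (eval_fuel k g (behead v))
  | Mu g =>
      let y := find (fun j => eval_fuel k g (j :: v) <= 1) (iota 0 k) in
      if eval_fuel k g (y :: v) == 1 then y.+1 else 0
  end.

Lemma eval_fuel_Mu k g v y :
  y <= k -> eval_fuel k g (y :: v) = 1 ->
  (forall i, i < y -> 1 < eval_fuel k g (i :: v)) ->
  eval_fuel k (Mu g) v = y.+1.
Proof.
move=> le_yk gy lt_y /=.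
set j := find _ _; case: (ltngtP j y) => [lt_jy|/before_find_iota|->].
- have : has (fun j => eval_fuel k g (j :: v) <= 1) (iota 0 k).
    by rewrite has_find size_iota (leq_trans lt_jy).
  move/(nth_find 0); rewrite nth_iota ?(leq_trans lt_jy) //.
  by rewrite leqNgt lt_y.
- by rewrite gy.
- by rewrite gy eqxx.
Qed.

Lemma eval_fuel_sound k f v y : eval_fuel k f v = y.+1 -> eval f v y.
Proof.
elim/recf_nested_ind: f v y => [||i|g hs IHg IHhs|g h IHg IHh|g IHg] v y.
- by case.
- by case.
- by case.
- rewrite eval_Comp /=; case: ifPn => // pos_hs gy.
  exists [seq w.-1 | w <- [seq eval_fuel k h v | h <- hs]]; last exact: IHg.
  elim: IHhs pos_hs {gy} => //= h hs' IHh _ IH.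
  rewrite in_cons negb_or eq_sym -lt0n => /andP[pos_h pos_hs'].
  by split; [apply: IHh; rewrite prednK | apply: IH].
- rewrite /=; elim: (head 0 v) y => [|m IH] y /=; first exact: IHg.
  case Em: (iteri m _ _) => [|z] //= hy.
  by exists z; [apply: IH | apply: IHh].
- rewrite /=; case: eqP => // gj [<-]; split; first exact: IHg.
  move=> i /before_find_iota; rewrite -ltnNge => gt1_i.
  exists (eval_fuel k g (i :: v)).-1; last by rewrite -subn1 subn_gt0.
  by apply: IHg; rewrite prednK // ltnW.
Qed.

Lemma eval_fuel_complete f v y :
  eval f v y -> \forall k \near \oo, eval_fuel k f v = y.+1.
Proof.
elim/recf_nested_ind: f v y => [||i|g hs IHg IHhs|g h IHg IHh|g IHg] v y.
- by move=> ->; apply: nearW.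
- by move=> ->; apply: nearW.
- by move=> ->; apply: nearW.
- rewrite eval_Comp => -[w hsw /IHg gy].
  have hsE : \forall k \near \oo,
      [seq eval_fuel k h v | h <- hs] = [seq x.+1 | x <- w].
    elim: IHhs w hsw {gy} => [|h hs' IHh _ IH] [|x w] //=; first by exists 0.
    case=> /IHh hx /IH hsw.
    by apply: filterS2 hx hsw => k -> ->.
  apply: filterS2 gy hsE => k gy /= ->.
  by rewrite -map_comp map_id gy; case: ifP => // /mapP[].
- rewrite /=; elim: (head 0 v) y => [|m IH] y /=; first exact: IHg.
  by case=> z /IH hz /IHh hy; apply: filterS2 hz hy => k -> /=.
- case=> /IHg gy gt_y.
  have near_gt : \forall k \near \oo, forall i : 'I_y,
      1 < eval_fuel k g (nat_of_ord i :: v).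
    apply: filter_forall => i; have [z /IHg gz z_gt0] := gt_y i (ltn_ord i).
    by apply: filterS gz => k ->.
  near=> k; apply: eval_fuel_Mu.
  + by near: k; exists y.
  + by near: k.
  + move=> i lt_iy; rewrite -[i]/(nat_of_ord (Ordinal lt_iy)).
    by move: (Ordinal _); near: k.
Unshelve. all: by end_near. Qed.

Lemma eval_fuelP f v y : eval f v y <-> exists k, eval_fuel k f v = y.+1.
Proof.
split=> [/eval_fuel_complete|[k]]; last exact: eval_fuel_sound.
exact: filter_ex.
Qed.

Lemma eval_functional f v y z : eval f v y -> eval f v z -> y = z.
Proof.
move=> /eval_fuel_complete fy /eval_fuel_complete fz.
have [k [fk]] := filter_ex (filterI fy fz).
by rewrite fk => -[].
Qed.

(* With the arguments themselves given by functions of [v], each induction step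
   only changes the list [Hs] and never has to permute arguments. *)
Definition fuel_recursive (f : recf) : Prop := forall a K Hs,
  recursive a K -> Forall (recursive a) Hs ->
  recursive a (fun v => eval_fuel (K v) f [seq H v | H <- Hs]).

Lemma fuel_recursive_Comp g hs :
  fuel_recursive g -> Forall fuel_recursive hs -> fuel_recursive (Comp g hs).
Proof.
move=> recg rechs a K Hs recK recHs.
pose vals := [seq (fun v => eval_fuel (K v) h [seq H v | H <- Hs]) | h <- hs].
have recvals : Forall (recursive a) vals.
  by apply/List.Forall_map; apply: List.Forall_impl rechs => h; apply.
have recpreds : Forall (recursive a) [seq (fun v => (V v).-1) | V <- vals].
  apply/List.Forall_map; apply: List.Forall_impl recvals => V.
  exact: recursive_pred.
apply: eq_recursive (recursive_if (recursive_mem0 recvals)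
  (recursive_const a 0) (recg _ _ _ recK recpreds)) => v _.
by rewrite /= -!map_comp.
Qed.

Lemma fuel_recursive_Prec g h :
  fuel_recursive g -> fuel_recursive h -> fuel_recursive (Prec g h).
Proof.
move=> recg rech a K Hs recK recHs.
have recbHs : Forall (recursive a) (behead Hs) by case: recHs.
have recn : recursive a (fun v => head 0 [seq H v | H <- Hs]).
  by case: recHs => [|H Hs' recH _]; first exact: recursive_const.
pose step_args := [:: nth 0 ^~ 0, (fun w => (nth 0 w 1).-1) &
  [seq (fun w => H (behead w)) | H <-
    [seq (fun w => H (behead w)) | H <- behead Hs]]].
have recargs : Forall (recursive a.+2) step_args.
  constructor; first exact: recursive_nth.
  constructor; first exact/recursive_pred/recursive_nth.
  by do 2!apply: Forall_recursive_behead.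
have recstep := recursive_if (recursive_eq0 (recursive_nth a.+2 1))
  (recursive_const _ 0)
  (rech _ _ _ (recursive_behead (recursive_behead recK)) recargs).
apply: eq_recursive (recursive_iteri recn (recg _ _ _ recK recbHs) recstep).
move=> v _ /=.
by rewrite behead_map; apply: eq_iteri => m z; rewrite -!map_comp.
Qed.

Lemma fuel_recursive_Mu g : fuel_recursive g -> fuel_recursive (Mu g).
Proof.
move=> recg a K Hs recK recHs.
pose test_args := nth 0 ^~ 0 :: [seq (fun w => H (behead w)) | H <- Hs].
have recargs : Forall (recursive a.+1) test_args.
  by constructor; [exact: recursive_nth | exact: Forall_recursive_behead].
have recy := recursive_find recK
  (recursive_leq (recg _ _ _ (recursive_behead recK) recargs)
                 (recursive_const _ 1)).
have recgy := recg _ _ _ recK (List.Forall_cons _ recy recHs).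
apply: eq_recursive (recursive_if (recursive_eq recgy (recursive_const a 1))
  (recursive_succ recy) (recursive_const a 0)) => v _.
by rewrite /=; under eq_find => j do rewrite -map_comp.
Qed.

Lemma recursive_eval_fuel f : fuel_recursive f.
Proof.
elim/recf_nested_ind: f => [||i|||].
- by move=> a K Hs _ _; exact: recursive_const.
- move=> a K Hs _ recHs; do 2!apply: recursive_succ.
  by case: recHs => [|H Hs' recH _] //=; exact: recursive_const.
- move=> a K Hs _ recHs; apply: recursive_succ.
  by elim: recHs i => [|H Hs' recH _ IH] [|i] //=; exact: recursive_const.
- exact: fuel_recursive_Comp.
- exact: fuel_recursive_Prec.
- exact: fuel_recursive_Mu.
Qed.

(** * Semidecidable predicates *)

Definition semidecidable (a : nat) (P : seq nat -> Prop) : Prop :=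
  exists f : recf, forall v, size v = a -> P v <-> exists y, eval f v y.

Lemma semidecidable_ex_recursive a (P : seq nat -> bool) :
  recursive a.+1 (fun v => P v : nat) ->
  semidecidable a (fun v => exists k, P (k :: v)).
Proof.
move=> recP; have [q qP] := recursive_negb recP; exists (Mu q) => v sv.
have qE k y : eval q (k :: v) y <-> y = ~~ P (k :: v).
  by apply: qP; rewrite /= sv.
split; last by case=> k [/qE qk _]; exists k; case: (P _) qk.
case/ex_minnP=> k Pk kmin; exists k; split; first by apply/qE; rewrite Pk.
move=> i lt_ik; exists 1 => //; apply/qE.
by case: (boolP (P _)) => // /kmin; rewrite leqNgt lt_ik.
Qed.

Lemma semidecidable_eval a f y Hs : Forall (recursive a) Hs ->
  semidecidable a (fun v => eval f [seq H v | H <- Hs] y).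
Proof.
move=> recHs.
have [|g gP] := @semidecidable_ex_recursive a (fun w =>
  eval_fuel (nth 0 w 0) f [seq H (behead w) | H <- Hs] == y.+1).
  apply: recursive_eq; last exact: recursive_const.
  apply: eq_recursive (recursive_eval_fuel f (recursive_nth _ 0)
    (Forall_recursive_behead recHs)) => w _.
  by rewrite -map_comp.
exists g => v sv; rewrite -gP // eval_fuelP.
by split=> -[k fk]; exists k; apply/eqP.
Qed.

Lemma semidecidable_and a P Q :
  semidecidable a P -> semidecidable a Q ->
  semidecidable a (fun v => P v /\ Q v).
Proof.
move=> [f fP] [g gQ]; exists (Comp (Proj 0) [:: f; g]) => v sv.
rewrite fP // gQ //; split.
  by case=> -[x fx] [y gy]; exists x; apply/eval_Comp2; exists x, y.
by case=> z /eval_Comp2[x [y [fx gy _]]]; split; [exists x | exists y].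
Qed.

(* Dovetailing: a single number bounds both the witness and the fuel. *)
Lemma semidecidable_ex a P :
  semidecidable a.+1 P -> semidecidable a (fun v => exists m, P (m :: v)).
Proof.
case=> f fP.
pose found k v := has (fun m => 0 < eval_fuel k f (m :: v)) (iota 0 k).
have [|g gP] := @semidecidable_ex_recursive a (fun w =>
  found (nth 0 w 0) (behead w)).
  pose test_args := nth 0 ^~ 0 :: projections 2 a.
  have recargs : Forall (recursive a.+2) test_args.
    constructor; first exact: recursive_nth.
    exact: Forall_recursive_projections.
  apply: eq_recursive (recursive_has (recursive_nth _ 0) (recursive_leq
    (recursive_const _ 1)
    (recursive_eval_fuel f (recursive_nth _ 1) recargs))) => -[|k v] //= [sv].
  rewrite /found; congr (nat_of_bool _); apply: eq_has => m.
  by rewrite map_projections //= ?sv // drop0.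
exists g => v sv; rewrite -gP //=; split; last first.
  case=> k /hasP[m _]; case E: eval_fuel => [|y] // _; exists m.
  by apply/fP; [rewrite /= sv | exists y; apply: eval_fuel_sound E].
case=> m /fP[|y /eval_fuel_complete fy]; first by rewrite /= sv.
near \oo => k; exists k; apply/hasP; exists m.
  by rewrite mem_iota add0n; near: k; exists m.+1.
by rewrite (_ : eval_fuel k f (m :: v) = y.+1) //; near: k.
Unshelve. all: by end_near. Qed.

(** * Programming languages *)

Lemma code_surj (Sigma : finType) : 0 < #|Sigma| ->
  forall n, exists w : seq Sigma, code w = n.
Proof.
move=> Sigma_gt0; elim/ltn_ind => -[|n] IH; first by exists [::].
have [w codew] := IH (n %/ #|Sigma|) (leq_ltn_trans (leq_div _ _) (ltnSn n)).
exists (enum_val (Ordinal (ltn_pmod n Sigma_gt0)) :: w).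
by rewrite /code /= -/(code w) codew enum_valK /= -divn_eq.
Qed.

Lemma code_inj (Sigma : finType) : injective (@code Sigma).
Proof.
elim=> [|a w IH] [|b w'] //= [eq_code].
have Sigma_gt0 : 0 < #|Sigma| by apply: leq_ltn_trans (ltn_ord (enum_rank a)).
have := congr1 (modn^~ #|Sigma|) eq_code.
have := congr1 (divn^~ #|Sigma|) eq_code.
rewrite !divnMDl // !divn_small // !addn0 !modnMDl !modn_small //.
by move=> /IH-> /val_inj/enum_rank_inj->.
Qed.

Lemma injective_size_unbounded (T : finType) (u : nat -> seq T) n :
  injective u -> exists i, n <= size (u i).
Proof.
move=> u_inj; apply: contrapT => /forallNP small.
have le_un i : size (u i) <= n by rewrite leqNgt; apply/negP => /ltnW/small.
pose b (i : 'I_(#|{: n.-bseq T}|).+1) := Bseq (le_un i).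
have /leq_card : injective b by move=> i j [/u_inj/val_inj].
by rewrite card_ord ltnn.
Qed.

Section Language.

Variables (Sigma : finType) (L : language Sigma).
Hypotheses (Sigma_gt0 : 0 < #|Sigma|) (L_complete : turing_complete L).

Lemma prog_size_unbounded n0 : exists2 n, n0 <= n & 0 < nprog L n.
Proof.
have [|s [_ sP]] := run_complete L_complete (F := fun z _ => Some z).
  by exists (Proj 0) => x y _ _ r /=; split=> [->|[->]].
have /card_gt0P[a _] := Sigma_gt0.
have [|i le_n0] := @injective_size_unbounded _ (fun i => s (nseq i a)) n0.
  move=> i j eq_s; rewrite -(size_nseq i a) -(size_nseq j a).
  have [_ /(_ [::])] := sP (nseq i a); have [_ /(_ [::])] := sP (nseq j a).
  by rewrite eq_s => -> [->].
exists (size (s (nseq i a))) => //; apply/card_gt0P.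
by exists (in_tuple (s (nseq i a))); rewrite inE; case: (sP (nseq i a)).
Qed.

Lemma prog_of_computable (s : seq Sigma -> seq Sigma) :
  computable1 predT (fun z => Some (code (s z))) ->
  exists2 e, prog L e & forall x, run L e x = Some (s x).
Proof.
case=> f fs.
have [|s' [_ s'P]] := run_complete L_complete (F := fun _ x => Some (s x)).
  exists (Comp f [:: Proj 1]) => z x _ _ r; rewrite eval_Comp1.
  split; first by case=> _ /= -> /fs-/(_ erefl).
  by move=> /= sx; exists (code x) => //; apply/fs.
by exists (s' [::]); case: (s'P [::]).
Qed.

(* If [s z] is a program for [F (run z z)] and [e] is a program for [s], then
   [run e e] is the program [s e] itself. *)
Lemma recursion_theorem F :
  computable2 predT predT (fun z x => omap (@code Sigma) (F z x)) ->
  exists2 P, prog L P & forall x, run L P x = F P x.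
Proof.
case=> f fF; have [u uP] := run_computable L_complete.
pose self_run (z p : seq Sigma) := eval u [:: code z; code z] (code p).
pose F_self z x :=
  if pselect (exists p, self_run z p) is left ex_p then F (sval (cid ex_p)) x
  else None.
have [|s [s_comp sP]] := run_complete L_complete (F := F_self).
  exists (Comp f [:: Comp u [:: Proj 0; Proj 0]; Proj 1]) => z x _ _ r.
  rewrite eval_Comp2 /F_self; split.
    case=> n [_ [/eval_Comp2[_ [_ [-> -> un]]] -> fn]].
    have [p codep] := code_surj Sigma_gt0 n; rewrite -codep in un fn.
    case: pselect => [ex_p|]; last by case; exists p.
    case: cid => q uq /=; apply/fF => //.
    by rewrite (eval_functional uq un).
  case: pselect => // ex_p; case: cid => p up Fr.
  exists (code p), (code x); split=> //; last exact/fF.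
  by apply/eval_Comp2; exists (code z), (code z).
have [e prog_e run_e] := prog_of_computable s_comp.
have [prog_se run_se] := sP e; exists (s e) => // x.
have selfE p : self_run e p <-> p = s e.
  by rewrite /self_run uP // run_e; split=> [[/code_inj]|->].
rewrite run_se /F_self; case: pselect => [ex_p|[]].
  by case: cid => p /selfE /= ->.
by exists (s e); apply/selfE.
Qed.

Lemma exists_prog_halts_empty_iff Q : semidecidable 1 Q ->
  exists2 P, prog L P & halts_empty L P <-> Q [:: code P].
Proof.
case=> f fQ.
have [|P prog_P run_P] := @recursion_theorem (fun z _ =>
  if `[< Q [:: code z] >] then Some [::] else None).
  exists (Comp Zero [:: Comp f [:: Proj 0]]) => z x _ _ r.
  rewrite eval_Comp1; case: asboolP => [/fQ[//|y fy]|notQ]; last first.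
    split=> // -[y /eval_Comp1[_ -> fy] _]; case: notQ.
    by apply/fQ => //; exists y.
  split=> [[_ _ ->] //|[<-]]; exists y => //.
  by apply/eval_Comp1; exists (code z).
by exists P => //; rewrite /halts_empty /halts run_P; case: asboolP.
Qed.

Section Tester.

Variables (T : tester Sigma) (eqv : rel (seq Sigma)).
Hypotheses (T_computable : tester_computable L T) (T_sound : sound L T).
Hypothesis eqv_computable : computable2 (prog L) (prog L)
  (fun pi pi' => Some (nat_of_bool (eqv pi pi'))).
Hypothesis eqv_halts : forall pi pi', prog L pi -> prog L pi' -> eqv pi pi' ->
  halts_empty L pi = halts_empty L pi'.

Lemma halts_iff_class_answered_No : exists2 P, prog L P &
  halts_empty L P <-> exists w, [/\ prog L w, eqv w P & T w = Some No].
Proof.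
have [isprog isprogP] := prog_decidable L_complete.
have [equiv equivP] := eqv_computable; have [test testP] := T_computable.
have [|P prog_P halts_P] := @exists_prog_halts_empty_iff (fun v => exists m,
    eval isprog [:: m] 1 /\ eval equiv [:: m; nth 0 v 0] 1 /\
    eval test [:: m] 0).
  have recm := Forall_recursive_projections 2 0 1.
  have recmp := Forall_recursive_projections 2 0 2.
  apply: (@semidecidable_ex 1 (fun w => eval isprog [:: nth 0 w 0] 1 /\
    eval equiv [:: nth 0 w 0; nth 0 w 1] 1 /\ eval test [:: nth 0 w 0] 0)).
  apply: semidecidable_and; first exact: semidecidable_eval recm.
  apply: semidecidable_and; first exact: semidecidable_eval recmp.
  exact: semidecidable_eval recm.
exists P => //; rewrite halts_P /=.
have isprogE w : eval isprog [:: code w] 1 <-> prog L w.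
  by rewrite isprogP //; case: (prog L w); split=> // -[].
split.
  case=> m; have [w <-] := code_surj Sigma_gt0 m.
  case=> /isprogE prog_w [/(equivP _ _ prog_w prog_P)[w_P]].
  move=> /(testP _ prog_w) Tw; exists w.
  split=> //; first by case: (eqv w P) w_P.
  by case: (T w) Tw => [[]|].
case=> w [prog_w w_P Tw]; exists (code w); split; first exact/isprogE.
by split; [apply/equivP; rewrite ?w_P | apply/testP; rewrite ?Tw].
Qed.

Lemma exists_hard_nonhalting_class : exists2 P, prog L P &
  forall w, prog L w -> eqv w P -> hard L T w /\ ~~ halts_empty L w.
Proof.
have [P prog_P halts_P] := halts_iff_class_answered_No.
have P_loops : ~~ halts_empty L P.
  apply/negP => P_halts; have /halts_P[w [prog_w w_P Tw]] := P_halts.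
  have [_ /(_ Tw)] := T_sound prog_w.
  by rewrite (eqv_halts prog_w prog_P w_P) P_halts.
exists P => // w prog_w w_P.
have w_loops : ~~ halts_empty L w by rewrite (eqv_halts prog_w prog_P w_P).
split=> //; rewrite /hard /answers_correctly.
case Tw: (T w) => [[]|] //; rewrite w_loops /=.
by case/negP: P_loops; apply/halts_P; exists w.
Qed.

End Tester.

Lemma sound_hard_nonhalting_frequent (R : realType) (T : tester Sigma) :
  computably_empty_frequent R L -> tester_computable L T -> sound L T ->
  hard_nonhalting_frequent R L T.
Proof.
case=> eqv [_ eqv_comp eqv_freq eqv_halts] T_comp T_sound.
have [P prog_P hard_P] :=
  exists_hard_nonhalting_class T_comp T_sound eqv_comp eqv_halts.
have [c c_gt0 [n0 freq_P]] := eqv_freq P prog_P.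
exists c => //; exists n0 => n /freq_P freq_n nprog_gt0.
rewrite ler_pdivlMr ?ltr0n //; apply: le_trans freq_n _.
rewrite ler_nat; apply: subset_leq_card; apply/subsetP => w.
rewrite !inE => /andP[prog_w w_P].
by have [-> ->] := hard_P w prog_w w_P; rewrite prog_w.
Qed.

Definition always_No : tester Sigma := fun=> Some No.

Lemma approx_always_No : approx L always_No.
Proof.
split; last by right.
by exists Zero => x _ r /=; split=> [->|[<-]].
Qed.

Lemma dbar_always_No n : dbar L always_No n = 0.
Proof.
apply/eqP; rewrite cards_eq0; apply/eqP/setP => w.
by rewrite !inE /hard /answers_correctly negbK andbN andbF.
Qed.

Lemma always_No_not_frequent (R : realType) :
  ~ hard_nonhalting_frequent R L always_No.
Proof.
case=> c c_gt0 [n0 freq]; have [n le_n0 nprog_gt0] := prog_size_unbounded n0.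
by have := freq n le_n0 nprog_gt0; rewrite dbar_always_No mul0r leNgt c_gt0.
Qed.

End Language.

Theorem theorem3 (R : realType) (Sigma : finType) (L : language Sigma)
  (Sigma_ge2 : 2 <= #|Sigma|)
  (L_complete : turing_complete L)
  (L_frequent : computably_empty_frequent R L) :
  [/\ forall T : tester Sigma, three_way L T ->
        hard_nonhalting_frequent R L T,
      forall T : tester Sigma, generic L T ->
        hard_nonhalting_frequent R L T
    & ~ (forall T : tester Sigma, approx L T ->
        hard_nonhalting_frequent R L T)].
Proof.
have Sigma_gt0 : 0 < #|Sigma| by exact: ltnW.
split=> [T [T_comp _ T_sound]|T [T_comp _ T_sound]|approx_frequent].
- exact: sound_hard_nonhalting_frequent.
- exact: sound_hard_nonhalting_frequent.
- apply: (always_No_not_frequent Sigma_gt0 L_complete).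
  exact/approx_frequent/approx_always_No.
Qed.
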